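(* The geometry $\widetilde{\mathrm{SL}_2(\mathbb R)}$ admits no Ricci soliton structure: if $M=\{(x_1,x_2,x_3)\in\mathbb R^3: x_2>0\}$ carries the metric $$g=\frac{dx_1^2+dx_2^2}{x_2^2}+\left(\frac{dx_1}{x_2}+dx_3\right)^2,$$ then there exist no smooth vector field $E$ on $M$ and constant $A\in\mathbb R$ with $-2\,\mathrm{Ricci}(g)=\mathcal L_Eg+2Ag$.
   Context: The geometry $\widetilde{\mathrm{SL}_2(\mathbb R)}$ is the Riemannian manifold $(M,g)$ written in the claim. $\mathrm{Ricci}(g)$ is the $(0,2)$ Ricci tensor and $\mathcal L_E$ the Lie derivative. *)

(* Defs.v *)
From mathcomp Require Import all_boot all_order all_algebra.
From mathcomp Require Import all_classical all_reals all_analysis.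

Set Implicit Arguments.
Unset Strict Implicit.
Unset Printing Implicit Defensive.

Import Order.TTheory GRing.Theory Num.Theory.
Import numFieldNormedType.Exports.

Local Open Scope classical_set_scope.
Local Open Scope ring_scope.

(* Everything below is expressed in a single global chart: the manifold is an
   open subset U of R^n, points and tangent vectors are row vectors, and a
   (0,2)-tensor field is the matrix-valued function of its components in the
   coordinate frame.  Fields are total functions on R^n, of which only the
   values on U are meaningful. *)

Section Calculus.
Variables (R : realType) (n : nat).
Implicit Types (f : 'rV[R]_n -> R) (U : set 'rV[R]_n) (i : 'I_n).

Definition partial i f : 'rV[R]_n -> R := 'D_(delta_mx 0 i) f.

Fixpoint Ck (k : nat) U f : Prop :=
  match k with
  | 0 => forall x, U x -> {for x, continuous f}
  | k'.+1 => (forall x, U x -> differentiable f x) /\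
             (forall i, Ck k' U (partial i f))
  end.

Definition smooth_on U f : Prop := forall k, Ck k U f.

Definition smooth_vector_field U (E : 'rV[R]_n -> 'rV[R]_n) : Prop :=
  forall i, smooth_on U (fun x => E x 0 i).

End Calculus.

Section RiemannianGeometry.
Variables (R : realType) (n : nat).
Implicit Types (g : 'rV[R]_n -> 'M[R]_n) (E : 'rV[R]_n -> 'rV[R]_n).
Implicit Types (x : 'rV[R]_n) (i j k l : 'I_n).

(* Gamma^k_ij, the Christoffel symbols of the Levi-Civita connection of g *)
Definition christoffel g k i j x : R :=
  2^-1 * \sum_l invmx (g x) k l *
    (partial i (fun y => g y j l) x + partial j (fun y => g y i l) x
     - partial l (fun y => g y i j) x).

(* The component R^l_kij determined by
   Rm(d_i, d_j) d_k = \sum_l R^l_kij d_l, where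
   Rm(X, Y) Z = D_X D_Y Z - D_Y D_X Z - D_[X,Y] Z. *)
Definition riemann g l k i j x : R :=
  partial i (christoffel g l j k) x - partial j (christoffel g l i k) x
  + \sum_p (christoffel g l i p x * christoffel g p j k x
            - christoffel g l j p x * christoffel g p i k x).

(* Ric(Y, Z) = trace (X |-> Rm(X, Y) Z), positive on round spheres *)
Definition ricci g x : 'M[R]_n := \matrix_(j, k) \sum_i riemann g i k i j x.

Definition lie_derivative E g x : 'M[R]_n :=
  \matrix_(i, j) \sum_k (E x 0 k * partial k (fun y => g y i j) x
                         + g x k j * partial i (fun y => E y 0 k) x
                         + g x i k * partial j (fun y => E y 0 k) x).

Definition tensor (a b : 'rV[R]_n) : 'M[R]_n := a^T *m b.

End RiemannianGeometry.

Section SL2Geometry.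
Variable R : realType.

(* Coordinates are indexed from 0, so x_2 is x 0 1 and dx_k is dx (k - 1). *)
Definition dx (k : 'I_3) : 'rV[R]_3 := delta_mx 0 k.

Definition SL2_space : set 'rV[R]_3 := [set x | 0 < x 0 1].

Definition SL2_metric (x : 'rV[R]_3) : 'M[R]_3 :=
  let x2 := x 0 1 in
  let theta := x2^-1 *: dx 0 + dx 2 in
  (x2 ^+ 2)^-1 *: (tensor (dx 0) (dx 0) + tensor (dx 1) (dx 1))
  + tensor theta theta.

End SL2Geometry.

(* Main.v *)
(* In the left-invariant coframe dx/y, dy/y, theta = dx/y + dz, with
   (x, y, z) = (x_1, x_2, x_3), the Ricci tensor is diag(-3/2, -3/2, 1/2).  Hence
   a soliton field E = (P, Q, S) satisfies
     L_E g = 2 al (dx^2 + dy^2) / y^2 + 2 be theta^2,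
   where al = 3/2 - A and be = -1/2 - A.  Prolonging this overdetermined linear
   system (differentiating it and using the symmetry of mixed partials) forces
   successively d_z Q = 0, d_z P = 0 and y d_x^2 Q = - al.  Since Q / y - al ln y
   does not depend on y, this gives al = 0 and then be = 0, contradicting
   al - be = 2. *)

Require Import Defs.
From mathcomp Require Import all_boot all_order all_algebra.
From mathcomp Require Import all_classical all_reals all_analysis.
From mathcomp Require Import ring lra.
Import Order.TTheory GRing.Theory Num.Theory.
Import numFieldNormedType.Exports.
Local Open Scope classical_set_scope.
Local Open Scope ring_scope.

(** * Symmetry of mixed partial derivatives *)

Lemma is_derive_line (R : realType) (V : normedModType R) (f : V -> R)
    (a v : V) (s : R) :
  derivable f (a + s *: v) v ->
  is_derive s 1 (fun t => f (a + t *: v)) ('D_v f (a + s *: v)).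
Proof.
have quotE : (fun h : R => h^-1 *: (((fun t => f (a + t *: v)) \o shift s)
    (h *: (1 : R)) - f (a + s *: v))) =
  (fun h => h^-1 *: ((f \o shift (a + s *: v)) (h *: v) - f (a + s *: v))).
  apply/funext => h /=; congr (_ *: (f _ - _)).
  by rewrite [h *: 1]mulr1 scalerDl addrCA.
move=> df; split; first by rewrite /derivable quotE.
by rewrite /derive quotE.
Qed.

Lemma MVT_line (R : realType) (V : normedModType R) (f : V -> R) (a v : V)
    (h : R) : 0 < h ->
  (forall s, 0 <= s <= h -> derivable f (a + s *: v) v) ->
  exists2 s, 0 <= s <= h &
    f (a + h *: v) - f a = 'D_v f (a + s *: v) * h.
Proof.
move=> h0 df.
have dphi s : 0 <= s <= h ->
    is_derive s 1 (fun t => f (a + t *: v)) ('D_v f (a + s *: v)).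
  by move=> sh; apply: is_derive_line; exact: df.
have [||c] := MVT (f := fun t => f (a + t *: v))
  (df := fun t => 'D_v f (a + t *: v)) h0.
- by move=> s; rewrite in_itv /= => /andP[s0 sh]; apply: dphi; rewrite !ltW.
- apply: derivable_within_continuous => s; rewrite in_itv /= => sh.
  by have [] := dphi _ sh.
rewrite in_itv /= => /andP[c0 ch]; rewrite scale0r addr0 subr0 => eqf.
by exists c => //; rewrite !ltW.
Qed.

(** The second difference is the increment along [u] of [g y = f (y + h *: v) - f y]. One mean value
    theorem along [u] turns it into an increment of ['D_u f] along [v], and a second one
    finishes. *)
Lemma second_difference_MVT (R : realType) (V : normedModType R) (f : V -> R)
    (x u v : V) (h : R) : 0 < h ->
  (forall s t, 0 <= s <= h -> 0 <= t <= h ->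
     derivable f (x + s *: u + t *: v) u /\
     derivable ('D_u f) (x + s *: u + t *: v) v) ->
  exists s t, [/\ 0 <= s <= h, 0 <= t <= h &
    f (x + h *: u + h *: v) - f (x + h *: u) - f (x + h *: v) + f x =
    'D_v ('D_u f) (x + s *: u + t *: v) * h ^+ 2].
Proof.
move=> h0 df.
have h_itv : 0 <= h <= h by rewrite lexx ltW.
have z_itv : 0 <= (0 : R) <= h by rewrite lexx ltW.
pose g y := f (y + h *: v) - f y.
have dg s : 0 <= s <= h -> is_derive (x + s *: u) u g
    ('D_u f (x + s *: u + h *: v) - 'D_u f (x + s *: u)).
  move=> sh.
  have [dfh _] := df _ _ sh h_itv.
  have [df0 _] := df _ _ sh z_itv; rewrite scale0r addr0 in df0.
  apply: is_deriveB; last exact: derivableP.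
  have quotE : (fun k : R => k^-1 *: (((fun y => f (y + h *: v)) \o
      shift (x + s *: u)) (k *: u) - f (x + s *: u + h *: v))) =
    (fun k => k^-1 *: ((f \o shift (x + s *: u + h *: v)) (k *: u) -
      f (x + s *: u + h *: v))).
    by apply/funext => k /=; rewrite !addrA.
  split; first by rewrite /derivable quotE; exact: dfh.
  by rewrite /derive quotE.
have [s sh gE] : exists2 s, 0 <= s <= h &
    g (x + h *: u) - g x = 'D_u g (x + s *: u) * h.
  by apply: (@MVT_line R V g x u h h0) => s /dg[].
have [t th DfE] : exists2 t, 0 <= t <= h &
    'D_u f (x + s *: u + h *: v) - 'D_u f (x + s *: u) =
    'D_v ('D_u f) (x + s *: u + t *: v) * h.
  apply: (@MVT_line R V ('D_u f) (x + s *: u) v h h0) => t th.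
  exact: (df s t sh th).2.
exists s, t; split => //.
rewrite expr2 mulrA -DfE; have [_ <-] := dg s sh; rewrite -gE /g; ring.
Qed.

(** Schwarz's argument: the second difference over a small parallelogram, divided by [h ^+ 2], is a
    value of either mixed derivative at some point of it. Continuity at [x] then brings the two
    mixed derivatives at [x] within any [e] of each other. *)
Lemma derive_comm (R : realType) (V : normedModType R) (f : V -> R)
    (x u v : V) :
  (\near x, derivable f x u) -> (\near x, derivable f x v) ->
  (\near x, derivable ('D_u f) x v) -> (\near x, derivable ('D_v f) x u) ->
  {for x, continuous ('D_v ('D_u f))} -> {for x, continuous ('D_u ('D_v f))} ->
  'D_v ('D_u f) x = 'D_u ('D_v f) x.
Proof.
move=> fu fv fuv fvu cuv cvu; apply/eqP; rewrite -subr_eq0 -normr_eq0.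
apply/eqP/le_anti/andP; split; last exact: normr_ge0.
apply/ler_addgt0Pr => e e0; rewrite add0r.
have e20 : 0 < e / 2 by rewrite divr_gt0.
have /nbhs_ballP[d /= d0 good] : \forall y \near x,
    [/\ derivable f y u /\ derivable ('D_u f) y v,
        derivable f y v /\ derivable ('D_v f) y u,
        `|'D_v ('D_u f) x - 'D_v ('D_u f) y| < e / 2 &
        `|'D_u ('D_v f) x - 'D_u ('D_v f) y| < e / 2].
  move/cvgrPdist_lt : cuv => /(_ _ e20) cuv.
  move/cvgrPdist_lt : cvu => /(_ _ e20) cvu.
  apply: filterS (filterI (filterI (filterI fu fuv) (filterI fv fvu))
    (filterI cuv cvu)).
  move=> y [[[dfu dfuv] [dfv dfvu]] [cu cv]].
  exact: And4 (conj dfu dfuv) (conj dfv dfvu) cu cv.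
(* The [+ 1] keeps [m] positive even when [u = v = 0]; since [h * m = d / 2], the whole
   parallelogram lies in the ball of radius [d]. *)
pose m := `|u| + `|v| + 1.
have m0 : 0 < m by rewrite ltr_wpDl// addr_ge0.
pose h := d / 2 / m.
have h0 : 0 < h by rewrite !divr_gt0.
have inball s t : 0 <= s <= h -> 0 <= t <= h -> ball x d (x + s *: u + t *: v).
  move=> /andP[s0 sh] /andP[t0 th].
  rewrite -ball_normE /= -addrA opprD addrA subrr add0r normrN.
  apply: (@le_lt_trans _ _ (h * m)); last by rewrite /h divfK ?gt_eqF//; lra.
  apply: (le_trans (ler_normD _ _)); rewrite !normrZ !ger0_norm//.
  rewrite /m !mulrDr mulr1 -[leLHS]addr0; apply: lerD; last exact: ltW.
  by apply: lerD; apply: ler_wpM2r.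
have [s [t [sh th E1]]] := second_difference_MVT _ _ f x u v h h0
  (fun s t sh th => let: And4 p _ _ _ := good _ (inball s t sh th) in p).
(* The second difference is symmetric in [u] and [v], so exchanging them evaluates the same
   quantity. *)
have [t' [s' [th' sh' E2]]] : exists t s, [/\ 0 <= t <= h, 0 <= s <= h &
    f (x + h *: v + h *: u) - f (x + h *: v) - f (x + h *: u) + f x =
    'D_u ('D_v f) (x + t *: v + s *: u) * h ^+ 2].
  apply: (second_difference_MVT _ _ f x v u h h0) => t1 s1 th1 sh1.
  rewrite (_ : x + t1 *: v + s1 *: u = x + s1 *: u + t1 *: v).
    by have [_ dvu _ _] := good _ (inball s1 t1 sh1 th1).
  by rewrite addrAC.
rewrite ![x + _ *: v + _]addrAC in E2.
have E : 'D_v ('D_u f) (x + s *: u + t *: v) =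
    'D_u ('D_v f) (x + s' *: u + t' *: v).
  have h20 : h ^+ 2 != 0 by rewrite expf_neq0// gt_eqF.
  rewrite [X in X + f x]addrAC in E2.
  by apply: (mulIf h20); exact: etrans (esym E1) E2.
have [_ _ c1 _] := good _ (inball s t sh th).
have [_ _ _ c2] := good _ (inball s' t' sh' th').
rewrite (_ : _ - _ = ('D_v ('D_u f) x - 'D_v ('D_u f) (x + s *: u + t *: v))
   - ('D_u ('D_v f) x - 'D_u ('D_v f) (x + s' *: u + t' *: v))); last first.
  by rewrite E opprB subrKA.
apply: le_trans (ler_normB _ _) (ltW _).
by rewrite [ltRHS]splitr; exact: ltrD c1 c2.
Qed.

(** * Smooth functions on an open set *)

Section SmoothOn.
Variables (R : realType) (n : nat) (U : set 'rV[R]_n).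
Hypothesis openU : open U.
Implicit Types (f g : 'rV[R]_n -> R) (x : 'rV[R]_n).

Lemma smooth_on_partial f (i : 'I_n) :
  smooth_on U f -> smooth_on U (partial i f).
Proof. by move=> sf k; exact: (sf k.+1).2. Qed.

Lemma smooth_on_derivable f x v : smooth_on U f -> U x -> derivable f x v.
Proof. by move=> sf Ux; apply: diff_derivable; exact: (sf 1%N).1. Qed.

Lemma partialC f (i j : 'I_n) x : smooth_on U f -> U x ->
  partial i (partial j f) x = partial j (partial i f) x.
Proof.
move=> sf Ux.
have der g v : smooth_on U g -> \near x, derivable g x v.
  move=> sg; apply: (@filterS _ _ _ U) (open_nbhs_nbhs (conj openU Ux)) => y Uy.
  exact: smooth_on_derivable.
apply: derive_comm; try exact: der; try exact/der/smooth_on_partial.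
- exact: (smooth_on_partial _ _ (smooth_on_partial _ j sf) 0%N x Ux).
- exact: (smooth_on_partial _ _ (smooth_on_partial _ i sf) 0%N x Ux).
Qed.

Lemma eq_on_partial f g (i : 'I_n) x : {in U, f =1 g} -> U x ->
  partial i f x = partial i g x.
Proof.
move=> fg Ux; apply: near_eq_derive.
apply: (@filterS _ _ _ U) (open_nbhs_nbhs (conj openU Ux)) => y Uy.
by apply: fg; rewrite inE.
Qed.

End SmoothOn.

(** * Prolongation of the soliton equation *)

Lemma is_derive_coord (R : realType) (n : nat) (j : 'I_n) (x v : 'rV[R]_n) :
  is_derive x v (fun y : 'rV[R]_n => y 0 j) (v 0 j).
Proof.
have quot_cvg : (fun h : R => h^-1 *: (((fun y : 'rV[R]_n => y 0 j) \o shift x)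
    (h *: v) - x 0 j)) @ 0^' --> v 0 j.
  apply: cvg_near_cst; near=> h; rewrite /= !mxE addrK.
  by rewrite /GRing.scale/= mulKf//; near: h; exact: nbhs_dnbhs_neq.
split; first exact: cvgP quot_cvg.
exact: cvg_lim quot_cvg.
Unshelve. all: by end_near. Qed.

Lemma open_SL2_space (R : realType) : open (@SL2_space R).
Proof.
apply: (@open_comp _ _ (fun x : 'rV[R]_3 => x 0 1) [set y : R | 0 < y]).
  by move=> x _; exact: coord_continuous.
exact: open_gt.
Qed.

Section SL2Relations.
Variable R : realType.
Notation U := (@SL2_space R).
Implicit Types (f g : 'rV[R]_3 -> R) (a b c d : R) (x : 'rV[R]_3).

(* Linear relations are kept in the shape y (c + a1 f1 + a2 f2) +
   (d + b1 g1 + b2 g2) = 0, padded with zero terms, so that this one Leibniz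
   rule differentiates all of them. *)
Lemma partial_relation (i : 'I_3) c a1 f1 a2 f2 d b1 g1 b2 g2 :
  smooth_on U f1 -> smooth_on U f2 -> smooth_on U g1 -> smooth_on U g2 ->
  (forall x, U x -> x 0 1 * (c + a1 * f1 x + a2 * f2 x) +
                    (d + b1 * g1 x + b2 * g2 x) = 0) ->
  forall x, U x ->
    x 0 1 * (a1 * partial i f1 x + a2 * partial i f2 x) +
    (i == 1)%:R * (c + a1 * f1 x + a2 * f2 x) +
    (b1 * partial i g1 x + b2 * partial i g2 x) = 0.
Proof.
move=> sf1 sf2 sg1 sg2 rel x Ux.
pose Y := fun y : 'rV[R]_3 => y 0 1.
pose F := Y * (cst c + a1 *: f1 + a2 *: f2) + (cst d + b1 *: g1 + b2 *: g2).
have F0 : partial i F x = 0.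
  rewrite (eq_on_partial R 3 U (open_SL2_space R) F (cst 0) i x _ Ux).
    exact: derive_cst.
  by move=> y; rewrite inE => Uy; exact: rel.
have dY : is_derive x (delta_mx 0 i) Y ((i == 1)%:R).
  by apply: is_derive_eq (is_derive_coord _ _ _ _ _) _; rewrite mxE eqxx eq_sym.
have der f : smooth_on U f -> is_derive x (delta_mx 0 i) f (partial i f x).
  by move=> sf; apply/derivableP; exact: smooth_on_derivable sf Ux.
have := der _ sf1; have := der _ sf2; have := der _ sg1; have := der _ sg2.
move=> dg2 dg1 df2 df1.
rewrite -[RHS]F0 /partial /F; apply/esym.
have d1 := is_deriveD (is_deriveD (is_derive_cst c x (delta_mx 0 i))
  (is_deriveZ a1 df1)) (is_deriveZ a2 df2).
have d2 := is_deriveD (is_deriveD (is_derive_cst d x (delta_mx 0 i))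
  (is_deriveZ b1 dg1)) (is_deriveZ b2 dg2).
have [_ ->] := is_deriveD (is_deriveM dY d1) d2.
rewrite /GRing.scale /= !add0r; congr (_ + _); congr (_ + _).
exact: mulrC.
Qed.

Notation "'d_x' f" := (partial 0 f) (at level 9, f at level 9).
Notation "'d_y' f" := (partial 1 f) (at level 9, f at level 9).
Notation "'d_z' f" := (partial 2 f) (at level 9, f at level 9).

(** [P], [Q], [S] are the components of the soliton field. The six relations are the components of
    the soliton equation, combined so as to clear denominators and separate the unknowns. *)
Variables (P Q S : 'rV[R]_3 -> R) (al be : R).
Hypotheses (sP : smooth_on U P) (sQ : smooth_on U Q) (sS : smooth_on U S).
Hypothesis eqQy : forall x, U x ->
  x 0 1 * d_y Q x - Q x - al * x 0 1 = 0.
Hypothesis eqSz : forall x, U x ->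
  x 0 1 * d_z S x + d_z P x - be * x 0 1 = 0.
Hypothesis eqSy : forall x, U x ->
  x 0 1 * d_y S x + d_x Q x + 2 * d_y P x = 0.
Hypothesis eqSx : forall x, U x ->
  x 0 1 * d_x S x - 2 * d_z S x + (al + be) = 0.
Hypothesis eqPx : forall x, U x ->
  x 0 1 * d_x P x - d_z P x - Q x - al * x 0 1 = 0.
Hypothesis eqQz : forall x, U x -> x 0 1 * (d_y P x + d_x Q x) - d_z Q x = 0.

Let sd (i : 'I_3) f : smooth_on U f -> smooth_on U (partial i f) :=
  smooth_on_partial R 3 U f i.
Let dC f (i j : 'I_3) x : smooth_on U f -> U x ->
  partial i (partial j f) x = partial j (partial i f) x :=
  partialC R 3 U (open_SL2_space R) f i j x.

(* Values are abstracted first, since ring and lra would otherwise compare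
   derivatives up to conversion, unfolding them to limits. *)
Ltac gen_values x :=
  repeat match goal with |- context [partial ?i ?f x] =>
    generalize (partial i f x) end;
  repeat match goal with |- context [P x] => generalize (P x) end;
  repeat match goal with |- context [Q x] => generalize (Q x) end;
  repeat match goal with |- context [S x] => generalize (S x) end;
  generalize (x 0 1); intros.

(** First prolongation: this lemma and the next five differentiate the six relations. The terms in
    [(i == 1)%:R] come from differentiating the factor [x 0 1]. *)
Lemma partial_eqQy i x : U x ->
  x 0 1 * partial i (d_y Q) x + (i == 1)%:R * (d_y Q x - al) - partial i Q x = 0.
Proof.
move=> Ux; rewrite -[RHS](partial_relation i (- al) 1 (d_y Q) 0 Q 0 (-1) Q 0 Q
  (sd _ _ sQ) sQ sQ sQ _ x Ux);
  first by gen_values x; ring.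
move=> y Uy; rewrite -[RHS](eqQy y Uy); gen_values y; ring.
Qed.

Lemma partial_eqSz i x : U x ->
  x 0 1 * partial i (d_z S) x + (i == 1)%:R * (d_z S x - be)
    + partial i (d_z P) x = 0.
Proof.
move=> Ux; rewrite -[RHS](partial_relation i (- be) 1 (d_z S) 0 Q 0 1 (d_z P)
  0 Q (sd _ _ sS) sQ (sd _ _ sP) sQ _ x Ux);
  first by gen_values x; ring.
move=> y Uy; rewrite -[RHS](eqSz y Uy); gen_values y; ring.
Qed.

Lemma partial_eqSy i x : U x ->
  x 0 1 * partial i (d_y S) x + (i == 1)%:R * d_y S x
    + partial i (d_x Q) x + 2 * partial i (d_y P) x = 0.
Proof.
move=> Ux; rewrite -[RHS](partial_relation i 0 1 (d_y S) 0 Q 0 1 (d_x Q)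
  2 (d_y P) (sd _ _ sS) sQ (sd _ _ sQ) (sd _ _ sP) _ x Ux);
  first by gen_values x; ring.
move=> y Uy; rewrite -[RHS](eqSy y Uy); gen_values y; ring.
Qed.

Lemma partial_eqSx i x : U x ->
  x 0 1 * partial i (d_x S) x + (i == 1)%:R * d_x S x
    - 2 * partial i (d_z S) x = 0.
Proof.
move=> Ux; rewrite -[RHS](partial_relation i 0 1 (d_x S) 0 Q (al + be) (-2)
  (d_z S) 0 Q (sd _ _ sS) sQ (sd _ _ sS) sQ _ x Ux);
  first by gen_values x; ring.
move=> y Uy; rewrite -[RHS](eqSx y Uy); gen_values y; ring.
Qed.

Lemma partial_eqPx i x : U x ->
  x 0 1 * partial i (d_x P) x + (i == 1)%:R * (d_x P x - al)
    - partial i (d_z P) x - partial i Q x = 0.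
Proof.
move=> Ux; rewrite -[RHS](partial_relation i (- al) 1 (d_x P) 0 Q 0 (-1)
  (d_z P) (-1) Q (sd _ _ sP) sQ (sd _ _ sP) sQ _ x Ux);
  first by gen_values x; ring.
move=> y Uy; rewrite -[RHS](eqPx y Uy); gen_values y; ring.
Qed.

Lemma partial_eqQz i x : U x ->
  x 0 1 * (partial i (d_y P) x + partial i (d_x Q) x)
    + (i == 1)%:R * (d_y P x + d_x Q x) - partial i (d_z Q) x = 0.
Proof.
move=> Ux; rewrite -[RHS](partial_relation i 0 1 (d_y P) 1 (d_x Q) 0 (-1)
  (d_z Q) 0 Q (sd _ _ sP) (sd _ _ sQ) (sd _ _ sQ) sQ _ x Ux);
  first by gen_values x; ring.
move=> y Uy; rewrite -[RHS](eqQz y Uy); gen_values y; ring.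
Qed.

(** * Elimination through integrability conditions *)

Let deltaE : (((0 == 1 :> 'I_3)%:R = 0 :> R) * ((1 == 1 :> 'I_3)%:R = 1 :> R) *
  ((2 == 1 :> 'I_3)%:R = 0 :> R))%type.
Proof. by []. Qed.

(** Multiplying relations by powers of [x 0 1] beforehand makes each elimination linear in the
    monomials, hence within reach of [lra]. *)
Let mul0E (a b : R) : b = 0 -> a * b = 0. Proof. by move->; rewrite mulr0. Qed.

Let y_neq0 x : U x -> x 0 1 != 0. Proof. by move/lt0r_neq0. Qed.

(** The y-derivative of [eqSz] and the z-derivative of [eqSy] both contain [d_y (d_z S)]; it is
    eliminated between them, then [d_z S] by [eqSz]. *)
Lemma Pyz_relation x : U x ->
  x 0 1 * d_y (d_z P) x + x 0 1 * d_x (d_z Q) x + d_z P x = 0.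
Proof.
move=> Ux; have h2 := eqSz x Ux; have h2y := partial_eqSz 1 x Ux.
have h3z := partial_eqSy 2 x Ux.
rewrite (dC _ 2 1 _ sS Ux) (dC _ 2 1 _ sP Ux) (dC _ 2 0 _ sQ Ux) in h3z.
have {}h2y := mul0E (x 0 1) _ h2y; have {}h3z := mul0E (x 0 1) _ h3z.
move: h2 h2y h3z; rewrite !deltaE.
gen_values x; lra.
Qed.

(** Integrability in x and y: the mixed derivative of [S] is eliminated between [eqSy] and [eqSx],
    that of [P] between [eqQz] and [eqPx]; the remaining terms reduce by the undifferentiated
    relations and [Pyz_relation]. *)
Lemma Qxz_relation x : U x ->
  x 0 1 * (2 * al - be + 2 * d_x (d_z Q) x + 0 * P x) +
  (0 + 4 * d_z P x + 0 * P x) = 0.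
Proof.
move=> Ux; have B := Pyz_relation x Ux.
have h1 := eqQy x Ux; have h2 := eqSz x Ux; have h4 := eqSx x Ux.
have h5 := eqPx x Ux.
have h3x := partial_eqSy 0 x Ux; have h4y := partial_eqSx 1 x Ux.
have h6x := partial_eqQz 0 x Ux; have h5y := partial_eqPx 1 x Ux.
have h3z := partial_eqSy 2 x Ux.
rewrite (dC _ 2 1 _ sS Ux) (dC _ 2 1 _ sP Ux) (dC _ 2 0 _ sQ Ux) in h3z.
rewrite (dC _ 1 0 _ sS Ux) in h4y; rewrite (dC _ 1 0 _ sP Ux) in h5y.
have {}h3x := mul0E (x 0 1 * x 0 1) _ h3x.
have {}h4y := mul0E (x 0 1 * x 0 1) _ h4y.
have {}h6x := mul0E (x 0 1) _ h6x; have {}h5y := mul0E (x 0 1) _ h5y.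
have {}h4 := mul0E (x 0 1) _ h4; have {}h3z := mul0E (x 0 1) _ h3z.
move: B h1 h2 h5 h3x h4y h6x h5y h4 h3z.
rewrite !deltaE.
gen_values x; lra.
Qed.

Lemma Pz_relation x : U x ->
  x 0 1 * (2 * al - be + 0 * P x + 0 * P x) + (0 + (-4) * d_z P x + 0 * P x) = 0.
Proof.
move=> Ux; have B := Pyz_relation x Ux.
(* By [eqQy], [d_z Q] satisfies Euler's equation of degree 1 in y. Its x-derivative removes the
   third derivative of [Q] from the y-derivative of [Qxz_relation]. *)
have hQyz z : U z -> z 0 1 * (0 + 1 * d_y (d_z Q) z + 0 * P z) +
    (0 + (-1) * d_z Q z + 0 * P z) = 0.
  move=> Uz; rewrite -[RHS](partial_eqQy 2 z Uz) (dC _ 2 1 _ sQ Uz).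
  by rewrite !deltaE; gen_values z; ring.
have h1xz := partial_relation 0 _ _ _ _ _ _ _ _ _ _
  (sd _ _ (sd _ _ sQ)) sP (sd _ _ sQ) sP hQyz x Ux.
have hy := partial_relation 1 _ _ _ _ _ _ _ _ _ _
  (sd _ _ (sd _ _ sQ)) sP (sd _ _ sP) sP Qxz_relation x Ux.
rewrite (dC _ 0 1 _ (sd _ _ sQ) Ux) in h1xz.
have {}hy := mul0E (x 0 1) _ hy; have {}h1xz := mul0E (x 0 1) _ h1xz.
move: B hy h1xz.
rewrite !deltaE.
gen_values x; lra.
Qed.

(** By [Pz_relation], [d_z P] depends on y only, so [P_zz = 0]. The differentiated relations then
    give in turn [S_zz = 0], [S_xz = 0], [P_xz = 0] and [Q_z = 0]. *)
Lemma Qz_vanishes x : U x -> x 0 1 * (0 + 0 * P x + 0 * P x) +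
  (0 + 1 * d_z Q x + 0 * P x) = 0.
Proof.
move=> Ux; have Pzz := partial_relation 2 _ _ _ _ _ _ _ _ _ _
  sP sP (sd _ _ sP) sP Pz_relation x Ux.
have h2z := partial_eqSz 2 x Ux; have h4z := partial_eqSx 2 x Ux.
have h2x := partial_eqSz 0 x Ux; have h5z := partial_eqPx 2 x Ux.
rewrite (dC _ 2 0 _ sS Ux) in h4z; rewrite (dC _ 2 0 _ sP Ux) in h5z.
have {}h4z := mul0E (x 0 1) _ h4z; have {}h2x := mul0E (x 0 1) _ h2x.
move: Pzz h2z h4z h2x h5z.
rewrite !deltaE.
gen_values x; lra.
Qed.

(** With [Q_xz = 0], [Qxz_relation] and [Pz_relation] differ only in the sign of [4 * d_z P]. *)
Lemma Pz_vanishes x : U x -> x 0 1 * (0 + 0 * P x + 0 * P x) +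
  (0 + 1 * d_z P x + 0 * P x) = 0.
Proof.
move=> Ux; have h := Pz_relation x Ux; have h' := Qxz_relation x Ux.
have Qxz := partial_relation 0 _ _ _ _ _ _ _ _ _ _
  sP sP (sd _ _ sQ) sP Qz_vanishes x Ux.
have {}Qxz := mul0E (x 0 1) _ Qxz.
move: h h' Qxz; rewrite !deltaE.
gen_values x; lra.
Qed.

(** Once [P_z] and [Q_z] vanish, [eqPx] and [eqQy] give [P_x = Q_y], so [y P_xy = al], while [eqQz]
    gives [Q_xx = - P_xy]. *)
Lemma Qxx_relation x : U x -> x 0 1 * (0 + 1 * d_x (d_x Q) x + 0 * P x) +
  (al + 0 * P x + 0 * P x) = 0.
Proof.
move=> Ux; apply: (mulfI (y_neq0 _ Ux)); rewrite mulr0.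
have h1 := eqQy x Ux; have h5 := eqPx x Ux.
have h6x := partial_eqQz 0 x Ux; have h5y := partial_eqPx 1 x Ux.
rewrite (dC _ 1 0 _ sP Ux) in h5y.
have Qxz := partial_relation 0 _ _ _ _ _ _ _ _ _ _
  sP sP (sd _ _ sQ) sP Qz_vanishes x Ux.
have Pyz := partial_relation 1 _ _ _ _ _ _ _ _ _ _
  sP sP (sd _ _ sP) sP Pz_vanishes x Ux.
have Pz := Pz_vanishes x Ux.
have {}h5y := mul0E (x 0 1) _ h5y; have {}h6x := mul0E (x 0 1) _ h6x.
have {}Qxz := mul0E (x 0 1) _ Qxz; have {}Pyz := mul0E (x 0 1) _ Pyz.
move: h1 h5 Pz h5y h6x Qxz Pyz.
rewrite !deltaE.
gen_values x; lra.
Qed.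

(** [eqQy] gives [y Q_xxy = Q_xx], whereas [Qxx_relation] gives [y Q_xxy = - Q_xx]. Hence [Q_xx = 0]
    and [al = 0]; [Pz_relation] then yields [be = 2 al = 0]. One point with y = 1 suffices. *)
Lemma homothety_constants_eq0 : al = 0 /\ be = 0.
Proof.
pose x : 'rV[R]_3 := const_mx 1.
have x1 : x 0 1 = 1 by rewrite mxE.
have Ux : U x by rewrite /SL2_space /= x1.
have h := Pz_relation x Ux; have Pz := Pz_vanishes x Ux.
have Qxx := Qxx_relation x Ux.
have hQxy z : U z -> z 0 1 * (0 + 1 * d_y (d_x Q) z + 0 * P z) +
    (0 + (-1) * d_x Q z + 0 * P z) = 0.
  move=> Uz; rewrite -[RHS](partial_eqQy 0 z Uz) (dC _ 0 1 _ sQ Uz).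
  by rewrite !deltaE; gen_values z; ring.
have h1xx := partial_relation 0 _ _ _ _ _ _ _ _ _ _
  (sd _ _ (sd _ _ sQ)) sP (sd _ _ sQ) sP hQxy x Ux.
have hy := partial_relation 1 _ _ _ _ _ _ _ _ _ _
  (sd _ _ (sd _ _ sQ)) sP sP sP Qxx_relation x Ux.
rewrite (dC _ 0 1 _ (sd _ _ sQ) Ux) in h1xx.
move: h Pz Qxx h1xx hy.
rewrite x1 !deltaE.
gen_values x; lra.
Qed.

End SL2Relations.

(** * Curvature of the metric *)

Lemma ord3_ind (P : 'I_3 -> Prop) : P 0 -> P 1 -> P 2 -> forall i, P i.
Proof.
move=> P0 P1 P2 [[|[|[|//]]] lti].
- by rewrite (_ : Ordinal lti = 0) //; exact: val_inj.
- by rewrite (_ : Ordinal lti = 1) //; exact: val_inj.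
- by rewrite (_ : Ordinal lti = 2) //; exact: val_inj.
Qed.

Lemma sum_ord3 (V : nmodType) (F : 'I_3 -> V) : \sum_i F i = F 0 + F 1 + F 2.
Proof.
rewrite !big_ord_recl big_ord0 addr0 addrA.
by congr (F _ + F _ + F _); exact: val_inj.
Qed.

Lemma val_ord3 : ((0 : 'I_3) = 0%N :> nat) * ((1 : 'I_3) = 1%N :> nat) *
  ((2 : 'I_3) = 2%N :> nat).
Proof. by []. Qed.

(* The isometries (x, y, z) |-> (c x, c y, z) make a tensor component with lower
   indices i, j and upper index k homogeneous in y, of degree
   weight k - weight i - weight j; the tables below list the values at y = 1.
   The truncated subtraction in the exponents of y^-1 is harmless: the
   coefficient is 0 whenever weight k > weight i + weight j. *)
Definition weight (i : nat) : nat := nth 0%N [:: 1; 1; 0]%N i.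

Definition metric_coef {R : realType} (i j : nat) : R :=
  nth 0 (nth [::] [:: [:: 2; 0; 1]; [:: 0; 1; 0]; [:: 1; 0; 1]] i) j.

Definition inv_metric_coef {R : realType} (i j : nat) : R :=
  nth 0 (nth [::] [:: [:: 1; 0; -1]; [:: 0; 1; 0]; [:: -1; 0; 2]] i) j.

Definition christoffel_coef {R : realType} (k i j : nat) : R :=
  nth 0 (nth [::] (nth [::]
    [:: [:: [:: 0; - (3 / 2); 0]; [:: - (3 / 2); 0; - 2^-1]; [:: 0; - 2^-1; 0]];
        [:: [:: 2; 0; 2^-1]; [:: 0; -1; 0]; [:: 2^-1; 0; 0]];
        [:: [:: 0; 1; 0]; [:: 1; 0; 2^-1]; [:: 0; 2^-1; 0]]] k) i) j.

Definition ricci_coef {R : realType} (i j : nat) : R :=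
  nth 0 (nth [::] [:: [:: -1; 0; 2^-1]; [:: 0; - (3 / 2); 0];
                      [:: 2^-1; 0; 2^-1]] i) j.

Ltac compute_coefs := rewrite ?val_ord3
  /ricci_coef /christoffel_coef /metric_coef /inv_metric_coef /weight /=;
  cbv [addn subn Nat.add Nat.sub].

Section SL2Curvature.
Variable R : realType.
Notation U := (@SL2_space R).
Notation g := (@SL2_metric R).
Implicit Types (x : 'rV[R]_3) (i j k l : 'I_3).

Lemma SL2_metricE x i j :
  g x i j = metric_coef i j * (x 0 1)^-1 ^+ (weight i + weight j).
Proof.
rewrite /SL2_metric /tensor !mxE !big_ord1 !mxE /=.
elim/ord3_ind: i; elim/ord3_ind: j; compute_coefs; rewrite -?exprVn; ring.
Qed.

Lemma invmx_SL2_metricE x i j : U x ->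
  invmx (g x) i j = inv_metric_coef i j * x 0 1 ^+ (weight i + weight j).
Proof.
move=> Ux; have y0 : x 0 1 != 0 by exact: lt0r_neq0.
pose B := \matrix_(i < 3, j < 3)
  (inv_metric_coef i j * x 0 1 ^+ (weight i + weight j)).
have gB : g x *m B = 1%:M.
  apply/matrixP => {}i {}j; rewrite !mxE sum_ord3 !SL2_metricE !mxE.
  by elim/ord3_ind: i; elim/ord3_ind: j; compute_coefs; field.
have [ug _] := mulmx1_unit gB.
have -> : invmx (g x) = B by rewrite -[RHS](mulKmx ug) gB mulmx1.
by rewrite mxE.
Qed.

Lemma partial_monomial (c : R) (m : nat) i x : U x ->
  partial i (fun y : 'rV[R]_3 => c * (y 0 1)^-1 ^+ m) x =
  - (i == 1 :> nat)%:R * m%:R * c * (x 0 1)^-1 ^+ m.+1.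
Proof.
move=> Ux; have y0 : x 0 1 != 0 by exact: lt0r_neq0.
have dY : is_derive x (delta_mx 0 i) (fun y : 'rV[R]_3 => y 0 1)
    (i == 1 :> nat)%:R.
  by apply: is_derive_eq (is_derive_coord _ _ _ _ _) _; rewrite mxE eqxx eq_sym.
have dV : is_derive x (delta_mx 0 i) (fun y : 'rV[R]_3 => (y 0 1)^-1)
    (- (x 0 1) ^- 2 * (i == 1 :> nat)%:R).
  case: dY => dY dYE; split; first exact: derivableV.
  by rewrite deriveV // dYE.
have dX := is_deriveX m dV.
have [_] := is_deriveZ c dX.
set F := (X in 'D__ X _); rewrite (_ : F = fun y => c * (y 0 1)^-1 ^+ m).
  rewrite /partial => ->; rewrite /GRing.scale /= -exprVn.
  (* The power rule has exponent [m.-1], so [m = 0] is separate; there the factor [m%:R] kills both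
     sides. *)
  case: m {dX F} => [|m]; first by rewrite !(mul0r, mulr0).
  by rewrite /= !exprS expr0; ring.
by apply/funext => y; rewrite /F fctE.
Qed.

Lemma partial_SL2_metricE i j k x : U x ->
  partial k (fun y => g y i j) x =
  - (k == 1 :> nat)%:R * (weight i + weight j)%:R * metric_coef i j *
    (x 0 1)^-1 ^+ (weight i + weight j).+1.
Proof.
move=> Ux; rewrite -partial_monomial//; congr (partial k _ x).
by apply/funext => y; exact: SL2_metricE.
Qed.

Lemma christoffelE k i j x : U x ->
  christoffel g k i j x = christoffel_coef k i j *
    (x 0 1)^-1 ^+ (weight i + weight j - weight k).
Proof.
move=> Ux; have y0 : x 0 1 != 0 by exact: lt0r_neq0.
rewrite /christoffel sum_ord3 !partial_SL2_metricE // !invmx_SL2_metricE //.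
move: (x 0 1) y0 => y y0.
by elim/ord3_ind: k; elim/ord3_ind: i; elim/ord3_ind: j;
  compute_coefs; field.
Qed.

Lemma riemannE l k i j x (e := fun a b c => (weight b + weight c - weight a)%N)
    (t := (x 0 1)^-1) : U x ->
  riemann g l k i j x =
    - (i == 1 :> nat)%:R * (e l j k)%:R * christoffel_coef l j k *
      t ^+ (e l j k).+1 +
    (j == 1 :> nat)%:R * (e l i k)%:R * christoffel_coef l i k *
      t ^+ (e l i k).+1 +
    \sum_(p < 3)
      (christoffel_coef l i p * t ^+ e l i p *
         (christoffel_coef p j k * t ^+ e p j k) -
       christoffel_coef l j p * t ^+ e l j p *
         (christoffel_coef p i k * t ^+ e p i k)).
Proof.
move=> Ux.
have dG a b c d : partial a (christoffel g b c d) x =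
    - (a == 1 :> nat)%:R * (e b c d)%:R * christoffel_coef b c d *
    t ^+ (e b c d).+1.
  (* The closed form of the Christoffel symbols holds only on [U]; openness allows differentiating
     it. *)
  rewrite -partial_monomial//; apply: (eq_on_partial _ _ U) => //.
    exact: open_SL2_space.
  by move=> y; rewrite inE => Uy; exact: christoffelE.
rewrite /riemann !dG; congr (_ + _); first by rewrite !mulNr opprK.
by apply: eq_bigr => p _; rewrite !christoffelE.
Qed.

Lemma ricciE i j x : U x ->
  ricci g x i j = ricci_coef i j * (x 0 1)^-1 ^+ (weight i + weight j).
Proof.
move=> Ux; rewrite mxE sum_ord3 !riemannE // !sum_ord3.
move: (x 0 1)^-1 => t.
by elim/ord3_ind: i; elim/ord3_ind: j; compute_coefs; field.
Qed.

Lemma lie_derivative_SL2E E i j x : U x ->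
  lie_derivative E g x i j = \sum_k
    (E x 0 k * (- (k == 1 :> nat)%:R * (weight i + weight j)%:R *
       metric_coef i j * (x 0 1)^-1 ^+ (weight i + weight j).+1) +
     metric_coef k j * (x 0 1)^-1 ^+ (weight k + weight j) *
       partial i (fun y => E y 0 k) x +
     metric_coef i k * (x 0 1)^-1 ^+ (weight i + weight k) *
       partial j (fun y => E y 0 k) x).
Proof.
move=> Ux; rewrite mxE; apply: eq_bigr => k _.
by rewrite partial_SL2_metricE // !SL2_metricE.
Qed.

End SL2Curvature.

(** * From the soliton equation to the six scalar relations *)

Ltac expand_soliton x y0 :=
  rewrite !lie_derivative_SL2E // !sum_ord3 !ricciE // !SL2_metricE;
  compute_coefs;
  repeat match goal with |- context [partial ?i ?f x] =>
    generalize (partial i f x) end;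
  generalize (x 0 1) y0; intros; field.

Theorem theorem5p3 (R : realType) :
  ~ exists (E : 'rV[R]_3 -> 'rV[R]_3) (A : R),
      smooth_vector_field (@SL2_space R) E /\
      forall x : 'rV[R]_3, SL2_space x ->
        - 2 *: ricci (@SL2_metric R) x =
        lie_derivative E (@SL2_metric R) x + (2 * A) *: SL2_metric x.
Proof.
case=> E [A [sE soliton]].
(* [e] is the defect of the soliton equation; each required relation is a combination of its
   components with coefficients monomial in y. *)
pose e i j x := lie_derivative E (@SL2_metric R) x i j +
  2 * A * SL2_metric x i j - (-2) * ricci (@SL2_metric R) x i j.
have e0 i j x : SL2_space x -> e i j x = 0.
  move=> Ux; apply/eqP; rewrite subr_eq0 eq_sym; apply/eqP.
  have := congr1 (fun M : 'M[R]_3 => M i j) (soliton x Ux).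
  by rewrite [LHS]mxE [RHS]mxE [X in _ = _ + X]mxE.
have y_neq0 (x : 'rV[R]_3) : SL2_space x -> x 0 1 != 0 by move/lt0r_neq0.
have [|||x Ux|x Ux|x Ux|x Ux|x Ux|x Ux|al0 be0] :=
  homothety_constants_eq0 R (fun y => E y 0 0) (fun y => E y 0 1)
    (fun y => E y 0 2) (3 / 2 - A) (- 2^-1 - A).
- exact: sE.
- exact: sE.
- exact: sE.
- transitivity (x 0 1 ^+ 3 / 2 * e 1 1 x); last by rewrite e0// mulr0.
  by rewrite /e; expand_soliton x (y_neq0 x Ux).
- transitivity (x 0 1 / 2 * e 2 2 x); last by rewrite e0// mulr0.
  by rewrite /e; expand_soliton x (y_neq0 x Ux).
- transitivity (x 0 1 ^+ 2 * e 0 1 x); last by rewrite e0// mulr0.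
  by rewrite /e; expand_soliton x (y_neq0 x Ux).
(* This combination cancels [Q] and the derivatives of [P]. *)
- transitivity (2 * x 0 1 * e 0 2 x - x 0 1 ^+ 2 / 2 * e 0 0 x - 2 * e 2 2 x).
    by rewrite /e; expand_soliton x (y_neq0 x Ux).
  by rewrite !e0 // !mulr0 !subr0.
(* This one cancels the derivatives of [S], and the last one below cancels its y-derivative. *)
- transitivity (x 0 1 ^+ 3 / 2 * e 0 0 x - x 0 1 ^+ 2 * e 0 2 x +
    x 0 1 / 2 * e 2 2 x).
    by rewrite /e; expand_soliton x (y_neq0 x Ux).
  by rewrite !e0 // !mulr0 subr0 addr0.
- transitivity (x 0 1 ^+ 3 * e 0 1 x - x 0 1 ^+ 2 * e 1 2 x).
    by rewrite /e; expand_soliton x (y_neq0 x Ux).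
  by rewrite !e0 // !mulr0 subr0.
- lra.
Qed.
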